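(* Let $X$ be a real separable Hilbert space, $U:=[-\tfrac12,\tfrac12]^{\mathbb N}$, let $\mu$ be a probability measure on $[-\tfrac12,\tfrac12]$ and $\boldsymbol\mu(\mathrm d\boldsymbol y):=\bigotimes_{j\ge1}\mu(\mathrm dy_j)$ the corresponding countable product probability measure on $U$. Let $p\in(0,1)$ and $k:=\lceil\frac1{1-p}\rceil$. Let $g\colon U\to X$, and for $s\in\mathbb N$ put $g_s(\boldsymbol y):=g(y_1,\ldots,y_s,0,0,\ldots)$. Suppose that: (1) for $\boldsymbol\mu$-a.e. $\boldsymbol y\in U$, $\|g(\boldsymbol y)-g_s(\boldsymbol y)\|_X\to0$ as $s\to\infty$; (2) there are a sequence $(\Theta_\ell)_{\ell\ge0}$ of nonnegative numbers and a sequence $\boldsymbol b=(b_j)_{j\ge1}$ of nonnegative numbers with $\boldsymbol b\in\ell^p(\mathbb N)$ and $b_1\ge b_2\ge\cdots$, such that $g$ is continuously differentiable up to order $k+1$ with $$\|\partial^{\boldsymbol\nu}g(\boldsymbol y)\|_X\le\Theta_{|\boldsymbol\nu|}\,\boldsymbol b^{\boldsymbol\nu}\quad\text{for all }\boldsymbol y\in U\text{ and all }\boldsymbol\nu\in\mathbb N_0^{\mathbb N}\text{ with }|\boldsymbol\nu|\le k+1;$$ (3) $\int_{-1/2}^{1/2}y\,\mu(\mathrm dy)=0$, and there is a constant $C_\mu\ge0$ such that $\int_{-1/2}^{1/2}|y|^m\,\mu(\mathrm dy)\le C_\mu$ for all integers $m\ge2$. Then $$\|g-g_s\|_{L^2_{\boldsymbol\mu}(U;X)}=\mathcal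 O\big(s^{-\frac1p+\frac12}\big),$$ where the implied coefficient is independent of $s$; that is, there is a constant $C>0$ independent of $s$ such that $\|g-g_s\|_{L^2_{\boldsymbol\mu}(U;X)}\le C\,s^{-\frac1p+\frac12}$ for all $s\ge1$.
   Context: For a multi-index $\boldsymbol\nu=(\nu_j)_{j\ge1}\in\mathbb N_0^{\mathbb N}$, $|\boldsymbol\nu|:=\sum_{j\ge1}\nu_j$ (so $|\boldsymbol\nu|<\infty$ means finitely supported). For a real sequence $\boldsymbol x=(x_j)_{j\ge1}$ and finitely supported $\boldsymbol\nu$, $\boldsymbol x^{\boldsymbol\nu}:=\prod_{j\ge1}x_j^{\nu_j}$ with the convention $0^0:=1$. $\partial^{\boldsymbol\nu}$ denotes the mixed partial derivative of order $\nu_j$ in each variable $y_j$. $L^2_{\boldsymbol\mu}(U;X)$ is the Hilbert space of equivalence classes (under $\boldsymbol\mu$-a.e. equality) of strongly $\boldsymbol\mu$-measurable functions $f\colon U\to X$ with $\|f\|_{L^2_{\boldsymbol\mu}(U;X)}:=\big(\int_U\|f(\boldsymbol y)\|_X^2\,\boldsymbol\mu(\mathrm d\boldsymbol y)\big)^{1/2}<\infty$. *)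

(* Defs.v *)
From HB Require Import structures.
From mathcomp Require Import all_boot all_order all_algebra finmap.
From mathcomp Require Import sesquilinear.
From mathcomp Require Import all_classical all_reals all_analysis.

Set Implicit Arguments.
Unset Strict Implicit.
Unset Printing Implicit Defensive.

Import Order.TTheory GRing.Theory Num.Theory.
Import numFieldNormedType.Exports.

Local Open Scope classical_set_scope.
Local Open Scope ring_scope.

(* Sequences are indexed from 0: the variable y_j (j >= 1) of the mathematical
   text is [y (j - 1)]. *)

Definition separable (T : topologicalType) : Prop :=
  exists2 D : set T, countable D & dense D.

(* For a complete normed space this says that it is a real Hilbert space with
   inner product [ip]; over a real field a positive definite Hermitian form for
   [idfun] is a symmetric bilinear one. *)
Definition norm_from_inner (R : realType) (X : normedModType R)
    (ip : {dot X for idfun}) : Prop :=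
  forall x : X, `|x| ^+ 2 = ip x x.

Section ParameterDomain.
Variable R : realType.

Definition unit_interval : set R := `[- 2^-1, 2^-1].

Definition cube : set (nat -> R) := [set y | forall j, unit_interval (y j)].

Definition cylinders : set (set (nat -> R)) :=
  \bigcup_(j in [set: nat])
    preimage_set_system setT (fun y : nat -> R => y j)
      (@measurable _ (measurableTypeR R)).

(* R^N with the product of the Borel sigma-algebras *)
Definition seqspace := g_sigma_algebraType cylinders.

(* A measure [mu] on [-1/2,1/2] is represented by a measure on R that gives full
   mass to the interval, and likewise for the product measure on the cube.  The
   condition below determines [P] uniquely, since the sets involved form a
   pi-system generating the sigma-algebra of [seqspace]. *)
Definition is_countable_power (mu : probability (measurableTypeR R) R)
    (P : probability seqspace R) : Prop :=
  forall (n : nat) (B : nat -> set (measurableTypeR R)),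
    (forall j, measurable (B j)) ->
    P [set y : nat -> R | forall j, (j < n)%N -> B j (y j)] =
      (\prod_(j < n) mu (B j))%E.

Definition truncate (s : nat) (y : nat -> R) : nat -> R :=
  fun j => if (j < s)%N then y j else 0.

Definition shift_coord (y : nat -> R) (j : nat) (h : R) : nat -> R :=
  fun i => if i == j then y i + h else y i.

End ParameterDomain.

Arguments unit_interval R : clear implicits.
Arguments cube R : clear implicits.
Arguments seqspace R : clear implicits.

Section Derivatives.
Variables (R : realType) (X : normedModType R).
Implicit Types (f : (nat -> R) -> X) (y : nat -> R).

(* The increments are restricted to the cube, so that derivatives are one-sided
   when [y j] is an endpoint of the interval. *)
Definition increments y (j : nat) : set_system R :=
  within [set h | cube R (shift_coord y j h)] 0^'.

Definition diff_quotient f y (j : nat) (h : R) : X :=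
  h^-1 *: (f (shift_coord y j h) - f y).

Definition has_partial (j : nat) f y : Prop :=
  cvg (diff_quotient f y j @ increments y j).

Definition partial (j : nat) f : (nat -> R) -> X :=
  fun y => lim (diff_quotient f y j @ increments y j).

Definition iter_partial (js : seq nat) f : (nat -> R) -> X := foldr partial f js.

Definition cube_section (n : nat) y : set {ptws nat -> R} :=
  [set z | cube R z /\ forall j, (n <= j)%N -> z j = y j].

(* All partial derivatives of order at most [m] exist on the cube and are
   jointly continuous in any finite number of variables.  This is implied by
   their continuity on the cube for the product or the uniform topology, and it
   suffices for the order of differentiation to be irrelevant. *)
Definition cont_diff (m : nat) f : Prop :=
  forall js : seq nat, (size js <= m)%N ->
    (forall n y, cube R y ->
       {within cube_section n y,
         continuous (iter_partial js f : {ptws nat -> R} -> X)}) /\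
    ((size js < m)%N ->
       forall j y, cube R y -> has_partial j (iter_partial js f) y).

End Derivatives.

Definition multiindex := {fsfun nat -> nat with 0%N}.

Definition mabs (nu : multiindex) : nat := (\sum_(j <- finsupp nu) nu j)%N.

Definition mpow (R : realType) (b : nat -> R) (nu : multiindex) : R :=
  \prod_(j <- finsupp nu) b j ^+ nu j.

Definition mpartial (R : realType) (X : normedModType R) (nu : multiindex)
    (f : (nat -> R) -> X) : (nat -> R) -> X :=
  iter_partial (flatten [seq nseq (nu j) j | j <- finsupp nu]) f.

Section BochnerL2.
Variables (d : measure_display) (T : measurableType d) (R : realType).
Variables (X : normedModType R) (P : {measure set T -> \bar R}) (A : set T).

Definition simple_function (f : T -> X) : Prop :=
  finite_set (range f) /\ forall x, measurable (f @^-1` [set x]).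

Definition strongly_measurable (f : T -> X) : Prop :=
  exists2 phi : nat -> T -> X, forall n, simple_function (phi n) &
    {ae P, forall y, A y -> phi n y @[n --> \oo] --> f y}.

Definition L2norm (f : T -> X) : \bar R :=
  ((\int[P]_(y in A) (`|f y| ^+ 2)%:E) `^ 2^-1)%E.

Definition in_L2 (f : T -> X) : Prop :=
  strongly_measurable f /\ (L2norm f < +oo)%E.

End BochnerL2.

(* Main.v *)
(* Write g_n for g with the variables after the n-th set to 0.  Interpolating g
   linearly in y_n between the nodes 0 and 1/2 gives
     g_n - g_(n-1) = y_n F_n + r_n,   |F_n| <= Theta_1 b_n,   |r_n| <= Theta_2 b_n^2 / 2,
   where F_n depends on y_1, ..., y_(n-1) only.  As mu is centred, the y_n F_n
   are martingale differences, hence orthogonal in L^2, and therefore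
     |g_N - g_s|_(L^2) <= Theta_1 (sum_(n > s) b_n^2)^(1/2) + Theta_2 sum_(n > s) b_n^2 / 2.
   For a nonincreasing b in l^p one has s b_s^p <= sum_n b_n^p, and
   b_n^2 <= b_s^(2-p) b_n^p for n > s, so sum_(n > s) b_n^2 = O(s^(1 - 2/p)).
   Orthogonality and measurability are obtained by rounding the variables to a finite grid, on
   whose cells (boxes) the product formula for P applies directly. *)

Require Import Defs.
From HB Require Import structures.
From mathcomp Require Import all_boot all_order all_algebra finmap.
From mathcomp Require Import sesquilinear.
From mathcomp Require Import all_classical all_reals all_analysis.
From mathcomp Require Import measurable_realfun ring lra.

Set Implicit Arguments.
Unset Strict Implicit.
Unset Printing Implicit Defensive.

Import Order.TTheory GRing.Theory Num.Theory.
Import numFieldNormedType.Exports.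

Local Open Scope classical_set_scope.
Local Open Scope ring_scope.

(** * Inner products and one-variable sections *)

Section InnerProduct.
Variables (R : realType) (X : normedModType R) (ip : {dot X for idfun}).
Implicit Types (x y z : X) (a : R).

Lemma ipDl x y z : ip (x + y) z = ip x z + ip y z.
Proof. exact: (linearDl ip z). Qed.

Lemma ipBl x y z : ip (x - y) z = ip x z - ip y z.
Proof. exact: (linearBl ip z). Qed.

Lemma ipBr x y z : ip x (y - z) = ip x y - ip x z.
Proof. exact: (linearBr ip x). Qed.

Lemma ipNl x y : ip (- x) y = - ip x y.
Proof. exact: (linearNl ip y). Qed.

Lemma ipZl a x y : ip (a *: x) y = a * ip x y.
Proof. exact: (linearZl_LR ip y a x). Qed.

Lemma ipZr a x y : ip x (a *: y) = a * ip x y.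
Proof. exact: (linearZr_LR ip x a y). Qed.

Lemma ipC x y : ip x y = ip y x.
Proof. by rewrite hermC /= expr0 mul1r. Qed.

Hypothesis hX : norm_from_inner ip.

Lemma norm_sqrD x y : `|x + y| ^+ 2 = `|x| ^+ 2 + `|y| ^+ 2 + 2 * ip x y.
Proof. by rewrite !hX ipDl ipC [ip y _]ipC !ipDl [ip y x]ipC; ring. Qed.

(** For [y] nonzero, the squared norm of [x] minus its projection onto the line of [y] is
    nonnegative; multiplying by [|y|^2] gives the squared inequality. *)
Lemma cauchy_schwarz x y : `|ip x y| <= `|x| * `|y|.
Proof.
have [->|y0] := eqVneq y 0; first by rewrite (linear0r ip) normr0 mulr_ge0.
rewrite -(@ler_pXn2r _ 2) ?nnegrE ?mulr_ge0// real_normK ?num_real// exprMn.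
have y2 : 0 < `|y| ^+ 2 by rewrite exprn_gt0// normr_gt0.
have := sqr_ge0 `|x + (- ip x y / `|y| ^+ 2) *: y|.
rewrite norm_sqrD normrZ exprMn real_normK ?num_real// ipZr => h.
rewrite -subr_ge0 [leRHS](_ : _ = `|y| ^+ 2 * (`|x| ^+ 2 +
  (- ip x y / `|y| ^+ 2) ^+ 2 * `|y| ^+ 2 + 2 * (- ip x y / `|y| ^+ 2 * ip x y))).
  by rewrite mulr_ge0// ltW.
by field; rewrite normr_eq0.
Qed.

End InnerProduct.

Section Sections.
Variables (R : realType) (X : normedModType R) (ip : {dot X for idfun}).
Hypothesis hX : norm_from_inner ip.
Implicit Types (f : (nat -> R) -> X) (y : nat -> R).

Definition upd y (j : nat) (t : R) : nat -> R := fun i => if i == j then t else y i.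

Lemma shift_upd y j t h : shift_coord (upd y j t) j h = upd y j (t + h).
Proof. by apply/funext => i; rewrite /shift_coord /upd; case: eqP. Qed.

Lemma updK y j : upd y j (y j) = y.
Proof. by apply/funext => i; rewrite /upd; case: eqP => [->|]. Qed.

Lemma cube_upd y j t : cube R y -> unit_interval R t -> cube R (upd y j t).
Proof. by move=> cy It i; rewrite /upd; case: eqP. Qed.

Lemma unit_intervalE (t : R) : unit_interval R t <-> - 2^-1 <= t <= 2^-1.
Proof. by rewrite /unit_interval /= in_itv. Qed.

(** Epsilon-delta form of [has_partial] along a section. The increment must keep [t + h] in the
    interval, so at an endpoint the quotients are one-sided. *)
Lemma diff_quotient_near f j y t : cube R y -> unit_interval R t ->
  has_partial j f (upd y j t) ->
  forall e, 0 < e -> exists2 d, 0 < d & forall h, `|h| < d -> h != 0 ->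
    unit_interval R (t + h) ->
    `|partial j f (upd y j t) -
       h^-1 *: (f (upd y j (t + h)) - f (upd y j t))| < e.
Proof.
move=> cy It /cvgrPdist_lt hp e e0.
move: {hp}(hp _ e0); rewrite /prop_near1 /increments /=.
rewrite /within /= /dnbhs /within /= => /nbhs_ballP[d /= d0 hd].
exists d => // h hlt h0 Ith.
have := hd h; rewrite /ball /= sub0r normrN shift_upd => /(_ hlt h0).
rewrite /diff_quotient shift_upd; apply; exact: cube_upd.
Qed.

(** The mean value theorem fails for vector-valued functions, so the section is first paired with a
    fixed [v]; the point [c] therefore depends on [v]. *)
Lemma section_MVT f j y a b (v : X) :
  (forall z, cube R z -> has_partial j f z) -> cube R y ->
  unit_interval R a -> unit_interval R b -> a < b ->
  exists2 c, a < c < b & ip (f (upd y j b) - f (upd y j a)) v =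
    ip (partial j f (upd y j c)) v * (b - a).
Proof.
move=> hf cy Ia Ib ab.
pose psi t := ip (f (upd y j t)) v.
pose dpsi t := ip (partial j f (upd y j t)) v.
have Iab t : a <= t <= b -> unit_interval R t.
  move: Ia Ib => /unit_intervalE/andP[a1 _] /unit_intervalE/andP[_ b1] /andP[t1 t2].
  by apply/unit_intervalE; rewrite (le_trans a1)//= (le_trans t2).
(* Adding 1 allows division by this bound on [|v|] even when [v] is zero. *)
have v0 : 0 < `|v| + 1 by rewrite ltr_wpDl.
have [c cab cE] : exists2 c, c \in `]a, b[%R & psi b - psi a = dpsi c * (b - a).
  apply: MVT => // [t|].
    rewrite in_itv/= => /andP[at_ tb].
    have It : unit_interval R t by apply: Iab; rewrite !ltW.
    have cv : (fun h : R => h^-1 *: ((psi \o shift t) (h *: 1) - psi t)) h @[h --> 0^'] -->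
        dpsi t.
      apply/cvgrPdist_lt => e e0.
      have [|d d0 hd] := diff_quotient_near cy It (hf _ (cube_upd j cy It)) (e := e / (`|v| + 1)).
        exact: divr_gt0.
      near=> h.
      have h0 : h != 0 by near: h; exact: nbhs_dnbhs_neq.
      have := hd h; rewrite h0 => /(_ _ isT).
      have Ith : unit_interval R (t + h).
        have h1 : `|h| < t - a by near: h; apply: dnbhs0_lt; rewrite subr_gt0.
        have h2 : `|h| < b - t by near: h; apply: dnbhs0_lt; rewrite subr_gt0.
        by apply: Iab; move: h1 h2; rewrite !ltr_norml; lra.
      move=> /(_ _ Ith) H.
      rewrite /psi /dpsi /= [h *: 1]mulr1 [h + t]addrC -ipBl /GRing.scale /= -ipZl -ipBl.
      apply: (le_lt_trans (cauchy_schwarz hX _ _)).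
      apply: (@le_lt_trans _ _ (`|partial j f (upd y j t) -
       h^-1 *: (f (upd y j (t + h)) - f (upd y j t))| * (`|v| + 1))).
        by rewrite ler_wpM2l// lerDl.
      rewrite -ltr_pdivlMr//; apply: H.
      by near: h; apply: dnbhs0_lt.
    apply: DeriveDef; first by apply/cvg_ex; exists (dpsi t).
    exact: cvg_lim cv.
  (* Continuity on the closed interval: near [t] the quotients lie within 1 of the possibly
     one-sided derivative, so increments are at most [K] times [|u - t|]. *)
  apply/subspace_continuousP => t; rewrite /= in_itv/= => tab.
  have It := Iab _ tab.
  have [|d d0 hd] := diff_quotient_near cy It (hf _ (cube_upd j cy It)) (e := 1); first by [].
  pose K := `|partial j f (upd y j t)| + 1.
  have K0 : 0 < K by rewrite ltr_wpDl.
  apply/cvgrPdist_lt => e e0.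
  have d'0 : 0 < e / (K * (`|v| + 1)) by rewrite divr_gt0// mulr_gt0.
  rewrite /prop_near1 /within /=; apply/nbhs_ballP.
  exists (Num.min d (e / (K * (`|v| + 1)))) => /=; first by rewrite lt_min d0.
  move=> u; rewrite /ball /= distrC lt_min in_itv/= => /andP[utd utd'] uab.
  have [->|ut] := eqVneq u t; first by rewrite subrr normr0.
  have h0 : u - t != 0 by rewrite subr_eq0.
  have := hd (u - t) utd h0; rewrite (_ : t + (u - t) = u); last ring.
  move=> /(_ (Iab _ uab)) H.
  have {}H : `|f (upd y j u) - f (upd y j t)| <= `|u - t| * K.
    have -> : f (upd y j u) - f (upd y j t) =
       (u - t) *: ((u - t)^-1 *: (f (upd y j u) - f (upd y j t))).
      by rewrite scalerA divff// scale1r.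
    rewrite normrZ ler_wpM2l// /K -[X in `|X|](subrK (partial j f (upd y j t))).
    by rewrite (le_trans (ler_normD _ _))// addrC lerD2l distrC ltW.
  rewrite /psi -ipBl (le_lt_trans (cauchy_schwarz hX _ _))// distrC.
  rewrite (@le_lt_trans _ _ (`|u - t| * K * (`|v| + 1)))//.
    by rewrite ler_pM// lerDl.
  by rewrite -mulrA -ltr_pdivlMr ?mulr_gt0.
exists c; first by rewrite in_itv in cab.
by rewrite ipBl.
Unshelve. all: by end_near. Qed.

(** Taking [v] to be the increment itself in [section_MVT] puts [|v|^2] on the left, and one factor
    [|v|] cancels after Cauchy-Schwarz. *)
Lemma section_lipschitz f j y a b K :
  (forall z, cube R z -> has_partial j f z) ->
  (forall z, cube R z -> `|partial j f z| <= K) -> cube R y ->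
  unit_interval R a -> unit_interval R b ->
  `|f (upd y j b) - f (upd y j a)| <= K * `|b - a|.
Proof.
move=> hf hK cy; wlog ab : a b / a < b => [W Ia Ib|Ia Ib].
  case: (ltgtP a b) => [ab|ba|->]; first by apply: W => //.
    by rewrite distrC (distrC b); apply: W => //.
  by rewrite !subrr !normr0 mulr0.
set v := _ - _.
have [c /andP[ac cb] cE] := section_MVT v hf cy Ia Ib ab.
have Ic : unit_interval R c.
  move: Ia Ib => /unit_intervalE/andP[a1 _] /unit_intervalE/andP[_ b1].
  by apply/unit_intervalE; rewrite (le_trans a1 (ltW ac))//= (le_trans (ltW cb)).
have [->|v0] := eqVneq v 0.
  rewrite normr0 mulr_ge0//; exact: le_trans (hK _ cy).
have vp : 0 < `|v| by rewrite normr_gt0.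
rewrite -(ler_pM2r vp) -expr2 hX cE -mulrA [X in K * X]mulrC mulrA.
rewrite (gtr0_norm (x := b - a)) ?subr_gt0// ler_pM2r ?subr_gt0//.
rewrite (le_trans (ler_norm _))// (le_trans (cauchy_schwarz hX _ _))//.
by rewrite ler_wpM2r// hK//; exact: cube_upd.
Qed.

(** Both differences are evaluated by the mean value theorem against the same [v], the remainder
    itself. This gives [|v|^2 = t <f'(c) - f'(c'), v>], where [f'] is [K]-Lipschitz, [|c - c'| <= 1]
    and [|t| <= 1/2]. *)
Lemma section_interpolation f j y t K :
  (forall z, cube R z -> has_partial j f z) ->
  (forall z, cube R z -> has_partial j (partial j f) z) ->
  (forall z, cube R z -> `|partial j (partial j f) z| <= K) -> cube R y ->
  unit_interval R t ->
  `|f (upd y j t) - f (upd y j 0) -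
    t *: (2 *: (f (upd y j 2^-1) - f (upd y j 0)))| <= K / 2.
Proof.
move=> hf hpf hK cy It; set v := (X in `|X|).
have K0 : 0 <= K := le_trans (normr_ge0 _) (hK _ cy).
have I0 : unit_interval R 0 by apply/unit_intervalE; lra.
have Ih : unit_interval R 2^-1 by apply/unit_intervalE; lra.
(* A form valid for any order of [a] and [b], since [t] may be negative or zero. *)
have mvt a b : unit_interval R a -> unit_interval R b -> exists2 c,
    unit_interval R c & ip (f (upd y j b) - f (upd y j a)) v =
    ip (partial j f (upd y j c)) v * (b - a).
  wlog ab : a b / a < b => [W Ia Ib|Ia Ib].
    case: (ltgtP a b) => [ab|ba|->]; first by apply: W => //.
      have [c Ic cE] := W _ _ ba Ib Ia; exists c => //.
      by rewrite -(opprB (f (upd y j a))) ipNl cE -mulrN opprB.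
    by exists b => //; rewrite !subrr (linear0l ip) mulr0.
  have [c /andP[ac cb] cE] := section_MVT v hf cy Ia Ib ab.
  exists c => //.
  move: Ia Ib => /unit_intervalE/andP[a1 _] /unit_intervalE/andP[_ b1].
  by apply/unit_intervalE; rewrite (le_trans a1 (ltW ac))//= (le_trans (ltW cb)).
have [c Ic cE] := mvt _ _ I0 It.
have [c' Ic' cE'] := mvt _ _ I0 Ih.
have vE : `|v| ^+ 2 = t * ip (partial j f (upd y j c) - partial j f (upd y j c')) v.
  by rewrite hX {1}/v ipBl !ipZl cE cE' ipBl; field.
have [->|v0] := eqVneq v 0; first by rewrite normr0 divr_ge0.
have vp : 0 < `|v| by rewrite normr_gt0.
rewrite -(ler_pM2r vp) -expr2 vE (le_trans (ler_norm _))// normrM.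
have t2 : `|t| <= 2^-1 by move/unit_intervalE: It; rewrite ler_norml.
have ipK : `|ip (partial j f (upd y j c) - partial j f (upd y j c')) v| <= K * `|v|.
  rewrite (le_trans (cauchy_schwarz hX _ _))// ler_wpM2r//.
  rewrite (le_trans (section_lipschitz hpf hK cy Ic' Ic))// ler_piMr//.
  by move/unit_intervalE: Ic; move/unit_intervalE: Ic'; rewrite ler_norml; lra.
by rewrite (le_trans (ler_pM _ _ t2 ipK))// mulrCA mulrA.
Qed.

End Sections.

(** * Rounding to a finite grid *)

Section Grid.
Variable R : realType.
Implicit Types (t : R) (y z : nat -> R) (n m i j : nat).

(** The cap at [m.+1], together with truncation to 0 of negative numbers, makes the index total and
    monotone on the whole real line. *)
Definition grid_index m t : nat := minn m.+1 (Num.truncn ((t + 2^-1) * m.+1%:R)).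

Definition grid_point m i : R := i%:R / m.+1%:R - 2^-1.

Lemma grid_index_le m t : (grid_index m t <= m.+1)%N.
Proof. exact: geq_minl. Qed.

Lemma grid_point_unit m i : (i <= m.+1)%N -> unit_interval R (grid_point m i).
Proof.
move=> im; apply/unit_intervalE; rewrite /grid_point.
have h : 0 <= i%:R / m.+1%:R :> R by rewrite divr_ge0.
have : i%:R / m.+1%:R <= 1 :> R by rewrite ler_pdivrMr// mul1r ler_nat.
by move: (i%:R / _) h => x; lra.
Qed.

Lemma grid_point_close m t : unit_interval R t ->
  `|t - grid_point m (grid_index m t)| <= m.+1%:R^-1.
Proof.
move=> /unit_intervalE/andP[t1 t2].
have m0 : 0 < m.+1%:R :> R by [].
have x0 : 0 <= (t + 2^-1) * m.+1%:R by rewrite mulr_ge0//; lra.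
have x1 : (t + 2^-1) * m.+1%:R <= m.+1%:R by rewrite ler_piMl//; lra.
have iE : grid_index m t = Num.truncn ((t + 2^-1) * m.+1%:R).
  apply/minn_idPr; rewrite -(ler_nat R); apply: le_trans x1.
  by rewrite truncn_le.
have /andP[h1 h2] := truncn_itv x0.
rewrite /grid_point iE -(ler_pM2r m0) mulVf ?gt_eqF// -[X in _ * X <= _](gtr0_norm m0) -normrM.
have -> : (t - ((Num.truncn ((t + 2^-1) * m.+1%:R))%:R / m.+1%:R - 2^-1)) * m.+1%:R =
    (t + 2^-1) * m.+1%:R - (Num.truncn ((t + 2^-1) * m.+1%:R))%:R.
  by field; rewrite gt_eqF.
move: h1 h2; rewrite -(natr1 (Num.truncn _)) ler_norml.
by move: (_ * _) => x; move: (Num.truncn x)%:R => z; lra.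
Qed.

Lemma grid_index_mono m t u : t <= u -> (grid_index m t <= grid_index m u)%N.
Proof.
move=> tu; rewrite /grid_index leq_min geq_minl /=.
by apply: leq_trans (geq_minr _ _) _; apply: le_truncn; rewrite ler_wpM2r// lerD2r.
Qed.

(** By monotonicity of the index its level sets are intervals. *)
Lemma measurable_grid_index m i :
  measurable ([set t | grid_index m t = i] : set (measurableTypeR R)).
Proof.
apply: is_interval_measurable => t u /= ti ui v /andP[tv vu].
by apply/eqP; rewrite eqn_leq -{1}ui -ti !grid_index_mono.
Qed.

(** The code lives in a finite type, so every function of it is simple and every event about it is a
    finite union of cells. *)
Definition grid_code n m y : {ffun 'I_n -> 'I_m.+2} :=
  [ffun j : 'I_n => inord (grid_index m (y j))].

Definition grid_decode n m (q : {ffun 'I_n -> 'I_m.+2}) : nat -> R :=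
  fun j => if insub j is Some j' then grid_point m (q j') else 0.

Definition grid_round n m y := grid_decode (grid_code n m y).

Lemma unit_interval0 : unit_interval R 0.
Proof. by apply/unit_intervalE; lra. Qed.

Lemma cube_grid_round n m y : cube R (grid_round n m y).
Proof.
move=> j; rewrite /grid_round /grid_decode; case: insubP => [j' _ _|_].
  by apply: grid_point_unit; rewrite -ltnS.
exact: unit_interval0.
Qed.

Lemma grid_round_close n m y j : cube R y -> (j < n)%N ->
  `|y j - grid_round n m y j| <= m.+1%:R^-1.
Proof.
move=> cy jn; rewrite /grid_round /grid_decode insubT ffunE /=.
rewrite inordK; first exact: grid_point_close.
by rewrite ltnS grid_index_le.
Qed.

Lemma measurable_coord j : measurable_fun setT (fun y : seqspace R => y j).
Proof.
move=> _ A mA; apply: sub_sigma_algebra.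
by exists j => //; exists A.
Qed.

Lemma measurable_coords (B : nat -> set (measurableTypeR R)) :
  (forall j, measurable (B j)) ->
  measurable ([set y | forall j, B j (y j)] : set (seqspace R)).
Proof.
move=> mB; rewrite (_ : mkset _ = \bigcap_j ((fun y : seqspace R => y j) @^-1` B j)).
  apply: bigcapT_measurable => j; rewrite -[X in measurable X]setTI.
  by apply: (@measurable_coord j); [exact: measurableT|exact: mB].
by apply/seteqP; split => y /= h j => [_|]; exact: h.
Qed.

Lemma measurable_unit_interval : measurable (unit_interval R : set (measurableTypeR R)).
Proof. exact: measurable_itv. Qed.

Lemma measurable_cube : measurable (cube R : set (seqspace R)).
Proof. exact: (measurable_coords (fun=> measurable_unit_interval)). Qed.

(** The sides of the box on which the code equals [q]; from index [n] on the side is the whole line,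
    so that the family is defined for all coordinates. *)
Definition grid_cell n m (q : {ffun 'I_n -> 'I_m.+2}) (j : nat) : set (measurableTypeR R) :=
  if insub j is Some j' then [set t | grid_index m t = q j'] else setT.

Lemma measurable_grid_cell n m (q : {ffun 'I_n -> 'I_m.+2}) j :
  measurable (grid_cell q j).
Proof.
by rewrite /grid_cell; case: insubP => // j' _ _; exact: measurable_grid_index.
Qed.

Lemma grid_codeE n m (q : {ffun 'I_n -> 'I_m.+2}) y :
  grid_code n m y = q <-> forall j, (j < n)%N -> grid_cell q j (y j).
Proof.
split=> [<- j jn|h].
  rewrite /grid_cell insubT /= ffunE /= inordK//.
  by rewrite ltnS grid_index_le.
apply/ffunP => j; have := h j (ltn_ord j).
rewrite /grid_cell (valK j).
by rewrite /grid_code ffunE => ->; rewrite inord_val.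
Qed.

Lemma measurable_grid_code n m (Q : set {ffun 'I_n -> 'I_m.+2}) :
  measurable ([set y | Q (grid_code n m y)] : set (seqspace R)).
Proof.
rewrite (_ : mkset _ = \bigcup_(q in Q) [set y : seqspace R | grid_code n m y = q]).
  apply: fin_bigcup_measurable => // q _.
  rewrite (_ : mkset _ = [set y | forall j, grid_cell q j (y j)]).
    exact: (measurable_coords (measurable_grid_cell q)).
  apply/seteqP; split => y /=.
    move=> /grid_codeE h j; have [/h//|nj] := ltnP j n.
    by rewrite /grid_cell insubF// ltnNge nj.
  by move=> h; apply/grid_codeE => j _.
apply/seteqP; split => y /=; first by move=> Qy; exists (grid_code n m y).
by move=> [q Qq qE]; rewrite qE.
Qed.

Lemma simple_grid_code (X : normedModType R) n m (F : {ffun 'I_n -> 'I_m.+2} -> X) :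
  simple_function (fun y : seqspace R => F (grid_code n m y)).
Proof.
split.
  apply: (@sub_finite_set _ _ (F @` setT)); last exact: finite_image.
  by move=> _ [y _ <-]; exists (grid_code n m y).
by move=> x; apply: (measurable_grid_code (fun q => F q = x)).
Qed.

Lemma measurable_fun_grid_code n m (F : {ffun 'I_n -> 'I_m.+2} -> R) (D : set (seqspace R)) :
  measurable_fun D (fun y : seqspace R => F (grid_code n m y)).
Proof.
apply: measurable_funTS => _ Y _; rewrite setTI.
exact: (measurable_grid_code (fun q => Y (F q))).
Qed.

(* On the cube a function in this class depends on the variables y_j with
   j < n only. *)
Definition lipschitz_first (V : normedZmodType R) n (f : (nat -> R) -> V) :=
  exists2 L : R, 0 <= L & forall y z, cube R y -> cube R z ->
    `|f y - f z| <= L * \sum_(j < n) `|y j - z j|.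

Lemma lipschitz_first_round (V : normedZmodType R) n (f : (nat -> R) -> V) :
  lipschitz_first n f -> exists2 L : R, 0 <= L & forall m y, cube R y ->
    `|f y - f (grid_round n m y)| <= L / m.+1%:R.
Proof.
move=> [L L0 hL]; exists (L * n%:R); first exact: mulr_ge0.
move=> m y cy; apply: (le_trans (hL _ _ cy (cube_grid_round n m y))).
rewrite -mulrA ler_wpM2l//.
apply: (@le_trans _ _ (\sum_(j < n) m.+1%:R^-1)).
  by apply: ler_sum => j _; exact: grid_round_close.
by rewrite sumr_const card_ord mulr_natl.
Qed.

Lemma lipschitz_first_bounded (V : normedZmodType R) n (f : (nat -> R) -> V) :
  lipschitz_first n f -> exists2 K : R, 0 <= K & forall y, cube R y -> `|f y| <= K.
Proof.
move=> [L L0 hL].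
have c0 : cube R (fun=> 0) by move=> j; exact: unit_interval0.
exists (`|f (fun=> 0)| + L * n%:R) => [|y cy]; first by rewrite addr_ge0// mulr_ge0.
rewrite -[X in `|X|](subrK (f (fun=> 0))) addrC (le_trans (ler_normD _ _))// lerD2l.
apply: (le_trans (hL _ _ cy c0)); rewrite ler_wpM2l//.
rewrite -[X in X%:R]card_ord -sumr_const; apply: ler_sum => j _.
by rewrite subr0 ler_norml; have /unit_intervalE := cy j; lra.
Qed.

(** On the cube [h] is the pointwise limit of its values at rounded points, which are functions of
    the grid code. *)
Lemma lipschitz_first_measurable n (h : (nat -> R) -> R) :
  lipschitz_first n h -> measurable_fun (cube R : set (seqspace R)) h.
Proof.
move=> lh; have [L L0 hL] := lipschitz_first_round lh.
apply: (@measurable_fun_cvg _ (seqspace R) R (cube R)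
  (fun m (y : seqspace R) => h (grid_round n m y))) => [m|y cy].
  exact: (measurable_fun_grid_code (fun q => h (grid_decode q))).
apply/cvgrPdist_le => e e0; near=> m.
apply: (le_trans (hL m y cy)); rewrite ler_pdivrMr// -ler_pdivrMl//.
rewrite (le_trans _ (_ : m%:R <= _)) ?ler_nat// mulrC; near: m.
exact: nbhs_infty_ger.
Unshelve. all: by end_near. Qed.

Lemma lipschitz_first_coord n j : (j < n)%N -> lipschitz_first n (fun y => y j : R).
Proof.
move=> jn; exists 1 => // y z _ _; rewrite mul1r.
by rewrite (bigD1 (Ordinal jn))//= lerDl sumr_ge0.
Qed.

Lemma lipschitz_firstS (V : normedZmodType R) n n' (f : (nat -> R) -> V) :
  (n <= n')%N -> lipschitz_first n f -> lipschitz_first n' f.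
Proof.
move=> nn' [L L0 hL]; exists L => // y z cy cz.
apply: (le_trans (hL _ _ cy cz)); rewrite ler_wpM2l//.
rewrite -!(big_mkord predT (fun j => `|y j - z j|)).
by rewrite [leRHS](@big_cat_nat _ _ _ n)//= lerDl sumr_ge0.
Qed.

Lemma lipschitz_firstD (V : normedZmodType R) n (f g : (nat -> R) -> V) :
  lipschitz_first n f -> lipschitz_first n g -> lipschitz_first n (fun y => f y + g y).
Proof.
move=> [L L0 hL] [M M0 hM]; exists (L + M) => [|y z cy cz]; first exact: addr_ge0.
rewrite opprD addrACA (le_trans (ler_normD _ _))// mulrDl lerD//; [exact: hL|exact: hM].
Qed.

Lemma lipschitz_firstB (V : normedZmodType R) n (f g : (nat -> R) -> V) :
  lipschitz_first n f -> lipschitz_first n g -> lipschitz_first n (fun y => f y - g y).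
Proof.
move=> lf [M M0 hM]; apply: lipschitz_firstD => //; exists M => // y z cy cz.
by rewrite -opprD normrN; exact: hM.
Qed.

(** The product rule for bounded Lipschitz functions, stated once to serve real products, scalar
    multiples and inner products. *)
Lemma lipschitz_first_bilinear (V W U : normedZmodType R) (B : V -> W -> U) n
    (f : (nat -> R) -> V) (g : (nat -> R) -> W) :
  (forall u u' w, B (u - u') w = B u w - B u' w) ->
  (forall u w w', B u (w - w') = B u w - B u w') ->
  (forall u w, `|B u w| <= `|u| * `|w|) ->
  lipschitz_first n f -> lipschitz_first n g ->
  lipschitz_first n (fun y => B (f y) (g y)).
Proof.
move=> BBl BBr nB lf lg.
have [K K0 hK] := lipschitz_first_bounded lf.
have [N N0 hN] := lipschitz_first_bounded lg.
move: lf lg => [L L0 hL] [M M0 hM].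
exists (L * N + K * M) => [|y z cy cz]; first by rewrite addr_ge0// mulr_ge0.
have -> : B (f y) (g y) - B (f z) (g z) = B (f y - f z) (g y) + B (f z) (g y - g z).
  by rewrite BBl BBr addrA subrK.
rewrite (le_trans (ler_normD _ _))// mulrDl.
apply: lerD; apply: (le_trans (nB _ _)).
  by rewrite mulrAC; apply: ler_pM => //; [exact: hL|exact: hN].
by rewrite -mulrA; apply: ler_pM => //; [exact: hK|exact: hM].
Qed.

End Grid.

(** * Independence of the coordinates *)

Section Independence.
Variables (R : realType) (mu : probability (measurableTypeR R) R).
Variable P : probability (seqspace R) R.
Hypothesis hmu : mu (unit_interval R) = 1%E.
Hypothesis hP : is_countable_power mu P.
Hypothesis mu_mean : (\int[mu]_(x in unit_interval R) x%:E = 0)%E.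

Lemma measurable_box n (B : nat -> set (measurableTypeR R)) :
  (forall j, measurable (B j)) ->
  measurable ([set y | forall j, (j < n)%N -> B j (y j)] : set (seqspace R)).
Proof.
move=> mB.
rewrite (_ : mkset _ = [set y : seqspace R | forall j, (if (j < n)%N then B j else setT) (y j)]).
  by apply: (@measurable_coords R (fun j => if (j < n)%N then B j else setT)) => j; case: ifP.
by apply/seteqP; split => y /= h j; have := h j; case: ifP => // _; apply.
Qed.

(** The complement is covered by countably many boxes, the [j]-th constraining only [y j] to leave
    the interval; each is null by the product formula. *)
Lemma cubeC_negligible : P (~` (cube R : set (seqspace R))) = 0%E.
Proof.
have mI : measurable (unit_interval R : set (measurableTypeR R)) := @measurable_unit_interval R.
have mC : measurable (~` (cube R : set (seqspace R))).
  by apply: measurableC; exact: measurable_cube.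
apply/(negligibleP P mC).
pose NB (j i : nat) : set (measurableTypeR R) := if i == j then ~` unit_interval R else setT.
have mNB j i : measurable (NB j i).
  by rewrite /NB; case: eqP => // _; exact: measurableC.
pose N j : set (seqspace R) := [set y | forall i, (i < j.+1)%N -> NB j i (y i)].
apply: (@negligibleS _ _ _ _ (\bigcup_j N j)).
  move=> y /existsNP[j yj]; exists j => // i _.
  by rewrite /NB; case: eqP => // ->.
apply: negligible_bigcup => j; exists (N j); split => //.
  exact: (@measurable_box j.+1 (NB j) (mNB j)).
apply: eq_trans (hP j.+1 (mNB j)) _.
by rewrite (bigD1 ord_max)//= /NB eqxx probability_setC// hmu subee// mul0e.
Qed.

Lemma bounded_integrable (D : set (seqspace R)) (f : seqspace R -> R) (K : R) :
  measurable D -> measurable_fun D f -> (forall y, D y -> `|f y| <= K) ->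
  P.-integrable D (EFin \o f).
Proof.
move=> mD mf hf; apply: measurable_bounded_integrable => //.
  by rewrite (le_lt_trans (probability_le1 _ _))// ltry.
exists K; split; first exact: num_real.
by move=> M KM y Dy; apply: le_trans (hf _ Dy) _; rewrite ltW.
Qed.

(* The law of y_n on the event [B_0 x ... x B_(n-1)] is a multiple of [mu]. *)
Lemma box_mean n (B : nat -> set (measurableTypeR R)) :
  (forall j, measurable (B j)) ->
  (\int[P]_(y in cube R `&` [set y | forall j, (j < n)%N -> B j (y j)]) (y n)%:E = 0)%E.
Proof.
move=> mB; set Q := [set y | _].
have mQ : measurable (Q : set (seqspace R)) by exact: measurable_box.
have mI : measurable (unit_interval R : set (measurableTypeR R)) := @measurable_unit_interval R.
(* The value 2 lies outside the interval, so the preimage of any part of the interval forces [y] to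
   be in [Q]. *)
pose phi (y : seqspace R) : measurableTypeR R := if y \in Q then y n else 2.
have mphi : measurable_fun setT phi.
  apply: measurable_fun_ifT => //; last exact: measurable_coord.
  by apply: (measurable_fun_bool true); rewrite setTI (_ : _ @^-1` _ = Q)//;
    apply/seteqP; split => y; [exact: set_mem|exact: mem_set].
have phiE A : A `<=` unit_interval R -> phi @^-1` A = Q `&` [set y | A (y n)].
  move=> AI; apply/seteqP; split => y /=; rewrite /phi.
    case: ifPn => [/set_mem//|_ /AI/unit_intervalE]; lra.
  by move=> [Qy Ay]; rewrite mem_set.
have mD : measurable (phi @^-1` unit_interval R : set (seqspace R)).
  by rewrite -[X in measurable X]setTI; exact: mphi.
have coordI : P.-integrable (phi @^-1` unit_interval R) (EFin \o phi).
  apply: (@bounded_integrable _ _ 1) => //; first exact: measurable_funTS.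
  by move=> y /= /unit_intervalE; rewrite ler_norml; lra.
have coordQ y : Q y -> phi y = y n by move=> Qy; rewrite /phi mem_set.
transitivity (\int[P]_(y in phi @^-1` unit_interval R) (phi y)%:E)%E.
  (* Up to a null set, requiring only [y n] to be in the interval is the same as requiring [y] to be
     in the cube. *)
  rewrite [RHS](negligible_integral (N := ~` (cube R : set (seqspace R))))//.
  - have -> : phi @^-1` unit_interval R `\` ~` (cube R : set (seqspace R)) = cube R `&` Q.
      rewrite setDE setCK phiE//; apply/seteqP; split => y /= [].
        by move=> [].
      by move=> cy Qy; split => //; split => //; exact: cy.
    by apply: eq_integral => y /set_mem[_ Qy]; rewrite coordQ.
  - by apply: measurableC; exact: measurable_cube.
  - exact: cubeC_negligible.
have PQ0 : 0 <= fine (P Q) by rewrite fine_ge0.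
have PQfin : P Q \is a fin_num by rewrite fin_num_measure.
transitivity (\int[mscale (NngNum PQ0) mu]_(x in unit_interval R) x%:E)%E.
  transitivity (\int[pushforward P phi]_(x in unit_interval R) x%:E)%E.
    by rewrite integral_pushforward.
  apply: eq_measure_integral => A mA AI.
  rewrite [LHS](_ : _ = P (phi @^-1` A))// phiE// /= /mscale /= fineK//.
  (* Appending [A] as side number [n] turns the event into a box with [n.+1] sides, whose
     probability factors as that of [Q] times [mu A]. *)
  pose BA j := if j == n then A else B j.
  have mBA j : measurable (BA j) by rewrite /BA; case: eqP.
  rewrite (_ : Q `&` _ = [set y : nat -> R | forall j, (j < n.+1)%N -> BA j (y j)]).
    apply: eq_trans (hP n.+1 mBA) _; rewrite big_ord_recr /= {2}/BA eqxx.
    congr (_ * _)%E; apply: eq_trans (esym (hP n mB)).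
    by apply: eq_bigr => i _; rewrite /BA ltn_eqF.
  apply/seteqP; split => y /=.
    move=> [Qy Ay] j; rewrite ltnS leq_eqVlt /BA => /predU1P[->|jn].
      by rewrite eqxx.
    by rewrite ltn_eqF//; exact: Qy.
  move=> h; split => [j jn|].
    by have := h j (ltnW jn); rewrite /BA ltn_eqF.
  by have := h n (ltnSn n); rewrite /BA eqxx.
have mid : measurable_fun (unit_interval R) (fun x : measurableTypeR R => x%:E).
  exact/measurable_EFinP.
have intI : mu.-integrable (unit_interval R) (fun x : measurableTypeR R => x%:E).
  apply: (@measurable_bounded_integrable _ _ _ _ (fun x : measurableTypeR R => x)) => //.
    by rewrite (le_lt_trans (probability_le1 _ _))// ltry.
  exists 1; split; first exact: num_real.
  by move=> M KM y /unit_intervalE Iy; rewrite /= ler_norml; lra.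
rewrite integralE !ge0_integral_mscale//; last 2 first.
- exact: measurable_funeneg.
- exact: measurable_funepos.
rewrite -muleBr//; first by rewrite -integralE mu_mean mule0.
apply: fin_num_adde_defr.
exact/integrable_fin_num/integrable_funepos.
Qed.

(** Rounding makes [h] constant on each cell, where the integral of [y n] vanishes by [box_mean];
    the rounding error tends to 0 as the grid is refined. *)
Lemma independent_mean_zero n (h : (nat -> R) -> R) : lipschitz_first n h ->
  \int[P]_(y in cube R) (y n * h y) = 0.
Proof.
move=> lh; have mC : measurable (cube R : set (seqspace R)) := @measurable_cube R.
have yn1 y : cube R y -> `|y n| <= 1.
  by move=> /(_ n) /unit_intervalE; rewrite ler_norml; lra.
have mcoord : measurable_fun (cube R : set (seqspace R)) (fun y => y n).
  by apply: measurable_funTS; exact: measurable_coord.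
have [K K0 hK] := lipschitz_first_bounded lh.
have mh := lipschitz_first_measurable lh.
have [L L0 hL] := lipschitz_first_round lh.
have round0 m : \int[P]_(y in cube R) (y n * h (grid_round n m y)) = 0.
  (* The contribution of the cell of [q]; at each [y] exactly one term of the sum over [q]
     survives. *)
  pose F (q : {ffun 'I_n -> 'I_m.+2}) (y : seqspace R) : R :=
    h (grid_decode R q) * (y n * \1_[set y | grid_code n m y = q] y).
  have mcell (q : {ffun 'I_n -> 'I_m.+2}) :
      measurable ([set y | grid_code n m y = q] : set (seqspace R)).
    exact: (measurable_grid_code (fun q' => q' = q)).
  have iF1 q : P.-integrable (cube R)
      (EFin \o (fun y : seqspace R => y n * \1_[set y | grid_code n m y = q] y)).
    apply: (@bounded_integrable _ _ 1) => //.
      by apply: measurable_funM => //; exact: measurable_indic.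
    move=> y cy; rewrite normrM mulr_ile1// ?yn1// indicE.
    by case: (_ \in _); rewrite ?normr1 ?normr0.
  have -> : \int[P]_(y in cube R) (y n * h (grid_round n m y)) =
      fine (\int[P]_(y in cube R) (\sum_(q <- enum {ffun 'I_n -> 'I_m.+2}) (F q y)%:E))%E.
    congr fine; apply: eq_integral => y _.
    rewrite sumEFin big_enum/= (bigD1 (grid_code n m y))//= big1 => [|q qy].
      by rewrite addr0 /F indicE mem_set// mulr1 mulrC.
    by rewrite /F indicE memNset ?mulr0//= => yq; rewrite yq eqxx in qy.
  rewrite integral_sum//; last first.
    by move=> q; exact: (integrableZl mC (h (grid_decode R q)) (iF1 q)).
  rewrite big1// => q _; rewrite /F.
  under eq_integral do rewrite EFinM.
  rewrite integralZl//; last exact: (iF1 q).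
  rewrite (_ : \int[P]_(y in cube R) _ = 0)%E ?mule0//.
  rewrite -[RHS](box_mean n (@measurable_grid_cell R n m q)).
  have -> : [set y : nat -> R | forall j, (j < n)%N -> grid_cell q j (y j)] =
      [set y | grid_code n m y = q].
    by apply/seteqP; split => y /= /grid_codeE.
  by rewrite integral_mkcondr; apply: eq_integral => y _; rewrite epatch_indic /= EFinM.
(* The integral is shown to be at most every [e > 0] by subtracting the vanishing integral on a grid
   fine enough that [L / m.+1%:R <= e]. *)
apply/eqP; rewrite -normr_le0; apply/ler_addgt0Pr => e e0; rewrite add0r.
have [m mE] : exists m : nat, L / m.+1%:R <= e.
  exists (Num.truncn (L / e)); rewrite ler_pdivrMr// -ler_pdivrMl// mulrC.
  by rewrite ltW// truncnS_gt.
have irnd : P.-integrable (cube R) (EFin \o (fun y : seqspace R => y n * h (grid_round n m y))).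
  apply: (@bounded_integrable _ _ K) => //.
    apply: measurable_funM => //.
    exact: (measurable_fun_grid_code (fun q => h (grid_decode R q))).
  move=> y cy; rewrite normrM -[leRHS]mul1r ler_pM ?yn1//.
  by apply: hK; exact: cube_grid_round.
have ih : P.-integrable (cube R) (EFin \o (fun y : seqspace R => y n * h y)).
  apply: (@bounded_integrable _ _ K) => //; first exact: measurable_funM.
  by move=> y cy; rewrite normrM -[leRHS]mul1r ler_pM ?yn1// hK.
rewrite -[X in `|X|]subr0 -[X in _ - X](round0 m) -RintegralB//.
have mdiff : measurable_fun (cube R : set (seqspace R))
    (fun y => y n * h y - y n * h (grid_round n m y)).
  apply: measurable_funB; apply: measurable_funM => //.
  exact: (measurable_fun_grid_code (fun q => h (grid_decode R q))).
have hdiff y : cube R y -> `|y n * h y - y n * h (grid_round n m y)| <= e.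
  move=> cy; rewrite -mulrBr normrM -[leRHS]mul1r ler_pM ?yn1//.
  exact: le_trans (hL _ _ cy) mE.
apply: (le_trans (le_normr_Rintegral _ _)) => //.
  exact: (@bounded_integrable _ _ e).
apply: (@le_trans _ _ (\int[P]_(y in cube R) e)).
  apply: le_Rintegral => //.
    apply: (@bounded_integrable _ _ e) => [//||y cy]; last by rewrite normr_id hdiff.
    exact: measurableT_comp.
  by apply: (@bounded_integrable _ _ e) => [//|//|y cy]; rewrite ger0_norm// ltW.
rewrite Rintegral_cst// ler_piMr ?(ltW e0)// -lee_fin fineK ?fin_num_measure//.
exact: probability_le1.
Qed.

End Independence.

(** * Multi-indices supported at one coordinate *)

Definition single_multiindex (j m : nat) : multiindex :=
  [fsfun _ in [fset j]%fset => m | 0%N].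

(** The order is written as a successor because the value 0 would leave the support empty. *)
Lemma finsupp_single j m : finsupp (single_multiindex j m.+1) = [fset j]%fset.
Proof.
apply/fsetP => i; rewrite mem_finsupp /single_multiindex fsfun_fun inE.
by case: ifP.
Qed.

Lemma single_multiindexE j m : single_multiindex j m j = m.
Proof. by rewrite /single_multiindex fsfun_fun inE eqxx. Qed.

Lemma mabs_single j m : mabs (single_multiindex j m.+1) = m.+1.
Proof. by rewrite /mabs finsupp_single big_seq_fset1 single_multiindexE. Qed.

Lemma mpow_single (R : realType) (b : nat -> R) j m :
  mpow b (single_multiindex j m.+1) = b j ^+ m.+1.
Proof. by rewrite /mpow finsupp_single big_seq_fset1 single_multiindexE. Qed.

Lemma mpartial_single (R : realType) (X : normedModType R) j m (f : (nat -> R) -> X) :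
  mpartial (single_multiindex j m.+1) f = iter_partial (nseq m.+1 j) f.
Proof.
rewrite /mpartial finsupp_single.
(* Two permuted lists of length at most one are equal, which fixes the enumeration. *)
have -> : enum_fset [fset j]%fset = [:: j].
  apply: perm_small_eq => //; apply: uniq_perm => // i.
  by rewrite mem_seq1; exact: in_fset1.
by rewrite /= single_multiindexE cats0.
Qed.

(** * Tails of monotone sequences in l^p *)

Section Stechkin.
Variables (R : realType) (p : R) (b : nat -> R).
Hypotheses (p_gt0 : 0 < p) (b_ge0 : forall j, 0 <= b j).
Hypothesis b_lp : cvgn (series (fun j => b j `^ p)).
Hypothesis b_noninc : forall j, b j.+1 <= b j.

Let B := limn (series (fun j => b j `^ p)).

Lemma noninc_le n m : (n <= m)%N -> b m <= b n.
Proof.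
move=> /subnK <-; elim: (m - n)%N => // d IH.
by rewrite addSn (le_trans (b_noninc _)).
Qed.

Lemma lp_sum_le n : \sum_(0 <= j < n) b j `^ p <= B.
Proof.
apply: nondecreasing_cvgn_le => //; apply/nondecreasing_seqP => k.
by rewrite /series /= big_nat_recr//= lerDl powR_ge0.
Qed.

Lemma lp_norm_ge0 : 0 <= B.
Proof. by have := lp_sum_le 0; rewrite big_nil. Qed.

Lemma lp_tail_le n m : \sum_(n <= j < m) b j `^ p <= B.
Proof.
apply: le_trans (lp_sum_le m).
have [nm|mn] := leqP n m; last first.
  by rewrite (big_geq (ltnW mn)); apply: sumr_ge0 => j _; exact: powR_ge0.
rewrite [leRHS](@big_cat_nat _ _ _ n)//= lerDr; apply: sumr_ge0 => j _.
exact: powR_ge0.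
Qed.

Lemma noninc_lp_le s : (1 <= s)%N -> b s <= (B / s%:R) `^ p^-1.
Proof.
move=> s1; have s0 : 0 < s%:R :> R by rewrite ltr0n.
rewrite -[leLHS]powRr1// -[X in _ `^ X <= _](mulfV (lt0r_neq0 p_gt0)) powRrM.
apply: ge0_ler_powR; rewrite ?nnegrE ?powR_ge0 ?invr_ge0 ?(ltW p_gt0)//.
  by rewrite divr_ge0 ?lp_norm_ge0// ltW.
rewrite ler_pdivlMr//; apply: le_trans (lp_sum_le s).
rewrite mulr_natr -[X in _ *+ X]subn0 -sumr_const_nat; apply: ler_sum_nat => j /andP[_ js].
by apply: ge0_ler_powR; rewrite ?nnegrE ?b_ge0 ?(ltW p_gt0)// noninc_le// ltnW.
Qed.

(** Write [b_j^2 = b_j^(2-p) b_j^p] and bound the first factor by its value at [s]. Raising [B / s]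
    to the power [(2-p)/p] then yields the exponent [1 - 2/p] of [s]. *)
Lemma lp_tail_sqr s m : p < 2 -> (1 <= s)%N ->
  \sum_(s <= j < m) b j ^+ 2 <= B `^ ((2 - p) / p) * B * s%:R `^ (1 - 2 / p).
Proof.
move=> p2 s1; have s0 : 0 < s%:R :> R by rewrite ltr0n.
have q0 : 0 <= 2 - p by lra.
apply: (@le_trans _ _ (\sum_(s <= j < m) b s `^ (2 - p) * b j `^ p)).
  apply: ler_sum_nat => j /andP[sj _].
  rewrite -powR_mulrn// -[X in b j `^ X](subrK p) powRD; last first.
    by rewrite subrK pnatr_eq0.
  rewrite ler_wpM2r ?powR_ge0//.
  by apply: ge0_ler_powR; rewrite ?nnegrE ?b_ge0// noninc_le.
rewrite -mulr_sumr.
apply: (@le_trans _ _ ((B / s%:R) `^ ((2 - p) / p) * B)).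
  apply: ler_pM; [exact: powR_ge0|by apply: sumr_ge0 => j _; exact: powR_ge0| |exact: lp_tail_le].
  rewrite [_ / p]mulrC powRrM; apply: ge0_ler_powR; rewrite ?nnegrE ?b_ge0 ?powR_ge0//.
  exact: noninc_lp_le.
rewrite powRM ?lp_norm_ge0 ?invr_ge0 ?(ltW s0)// mulrAC.
rewrite ler_wpM2l ?mulr_ge0 ?powR_ge0 ?lp_norm_ge0//.
rewrite -powR_inv1 ?(ltW s0)// -powRrM (_ : -1 * _ = 1 - 2 / p)//.
by field; rewrite gt_eqF.
Qed.

(** Comparison via [b_j = b_j^(1-p) b_j^p <= b_0^(1-p) b_j^p]. *)
Lemma lp_summable : p <= 1 -> cvgn (series b).
Proof.
move=> p1; apply: (@series_le_cvg _ _ (fun j => b 0 `^ (1 - p) * b j `^ p)) => //.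
- by move=> j; rewrite mulr_ge0 ?powR_ge0.
- move=> j; rewrite -[leLHS]powRr1// -[X in _ `^ X <= _](subrK p 1) powRD; last first.
    by rewrite subrK oner_eq0.
  rewrite ler_wpM2r ?powR_ge0//.
  by apply: ge0_ler_powR; rewrite ?nnegrE ?b_ge0 ?noninc_le//; lra.
- exact: is_cvg_seriesZ.
Qed.

Lemma lp_tail_small (e : R) : p <= 1 -> 0 < e ->
  exists N, forall s m, (N <= s)%N -> \sum_(s <= j < m) b j <= e.
Proof.
move=> p1 e0; have bcvg := lp_summable p1.
move: (bcvg) => /cvgrPdist_le /(_ _ e0) [N _ hN].
have mono : {homo series b : n m / (n <= m)%N >-> n <= m}.
  by apply/nondecreasing_seqP => k; rewrite /series /= big_nat_recr//= lerDl.
exists N => s m Ns; have [sm|ms] := leqP s m; last by rewrite big_geq ?ltW// ltnW.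
rewrite -sub_series_geq//; apply: le_trans (hN s Ns).
apply: le_trans (ler_norm _); rewrite lerD2r.
exact: nondecreasing_cvgn_le.
Qed.

End Stechkin.

(** * Comparison of integrals without measurability of the smaller function *)

Section DominatedAlmostEverywhere.
Import HBNNSimple.
Local Open Scope ereal_scope.
Context d (T : measurableType d) (R : realType).
Variables (mu : {measure set T -> \bar R}) (D : set T).

(* [f] is not assumed to be measurable; its integral is then the supremum of
   the integrals of the simple functions below it. *)
Lemma ae_ge0_le_integral_dominated (f w : T -> \bar R) :
  measurable D -> (forall x, D x -> 0 <= f x) ->
  (forall x, D x -> 0 <= w x) -> measurable_fun D w ->
  {ae mu, forall x, D x -> f x <= w x} ->
  \int[mu]_(x in D) f x <= \int[mu]_(x in D) w x.
Proof.
move=> mD f0 w0 mw fw; rewrite ge0_integralE//.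
apply: ge_ereal_sup => _ [h /= hf <-].
rewrite -integralT_nnsfun [leRHS]integral_mkcond.
apply: ae_ge0_le_integral => //.
- by move=> x _; rewrite lee_fin; exact: fun_ge0.
- exact/measurable_EFinP.
- by move=> x _; rewrite /patch; case: ifPn => // /set_mem /w0.
- exact/(measurable_restrictT _ mD).
- apply: filterS fw => x fwx _; apply: (le_trans (hf x)).
  by rewrite /patch; case: ifPn => // /set_mem.
Qed.

End DominatedAlmostEverywhere.

(** * The truncation error *)

Section Truncation.
Variables (R : realType).
Implicit Types (y z : nat -> R) (n : nat).

Lemma cube_truncate n y : cube R y -> cube R (truncate n y).
Proof. by move=> cy j; rewrite /truncate; case: ifP => // _; exact: unit_interval0. Qed.

Lemma truncateS n y : truncate n.+1 y = upd (truncate n y) n (y n).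
Proof.
apply/funext => j; rewrite /truncate /upd ltnS leq_eqVlt.
by case: eqP => [->|].
Qed.

Lemma upd_truncate0 n y : upd (truncate n y) n 0 = truncate n y.
Proof.
by apply/funext => j; rewrite /truncate /upd; case: eqP => // ->; rewrite ltnn.
Qed.

End Truncation.

Section TruncationError.
Variables (R : realType) (X : normedModType R) (ip : {dot X for idfun}).
Hypothesis hX : norm_from_inner ip.
Variables (mu : probability (measurableTypeR R) R) (P : probability (seqspace R) R).
Hypothesis hmu : mu (unit_interval R) = 1%E.
Hypothesis hP : is_countable_power mu P.
Hypothesis mu_mean : (\int[mu]_(x in unit_interval R) x%:E = 0)%E.
Variables (g : (nat -> R) -> X) (b : nat -> R) (c1 c2 : R).
Hypotheses (c1_ge0 : 0 <= c1) (b_ge0 : forall j, 0 <= b j).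
Hypothesis b_noninc : forall j, b j.+1 <= b j.
Hypothesis g_partial : forall j z, cube R z -> has_partial j g z.
Hypothesis g_partial2 : forall j z, cube R z -> has_partial j (partial j g) z.
Hypothesis g_bound1 : forall j z, cube R z -> `|partial j g z| <= c1 * b j.
Hypothesis g_bound2 : forall j z, cube R z ->
  `|partial j (partial j g) z| <= c2 * b j ^+ 2.
Implicit Types (y z : nat -> R) (n s N : nat).

(** The coordinates are exchanged one at a time and the increments telescoped. The constant is
    independent of [n], which matters when [n] and the grid grow together. *)
Lemma truncate_lipschitz n y z : cube R y -> cube R z ->
  `|g (truncate n y) - g (truncate n z)| <= (c1 * b 0) * \sum_(j < n) `|y j - z j|.
Proof.
move=> cy cz.
(* Hybrid points: entries of [z] below [i], of [y] from [i] up to [n], and 0 afterwards. *)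
pose w i j : R := if (j < n)%N then if (j < i)%N then z j else y j else 0.
have cw i : cube R (w i).
  by move=> j; rewrite /w; case: ifP => _; [case: ifP|exact: unit_interval0].
have -> : truncate n y = w 0 by [].
have -> : truncate n z = w n.
  by apply/funext => j; rewrite /truncate /w; case: ifP.
have wS i : w i.+1 = if (i < n)%N then upd (w i) i (z i) else w i.
  apply/funext => j; case: ifP => iN; rewrite /w /upd (ltnS j) (leq_eqVlt j).
    by case: eqP => [->|//]; rewrite iN.
  by case: ifP => // jn; case: eqP => // ji; rewrite -ji jn in iN.
have -> : g (w 0) - g (w n) = - \sum_(0 <= i < n) (g (w i.+1) - g (w i)).
  by rewrite (telescope_sumr (fun i => g (w i)))// opprB.
rewrite normrN big_mkord mulr_sumr.
apply: (le_trans (ler_norm_sum _ _ _)); apply: ler_sum => i _.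
have wi : upd (w i) i (y i) = w i.
  by rewrite -[RHS](updK _ i) {3}/w ltn_ord ltnn.
rewrite wS ltn_ord -[X in _ - g X]wi (distrC (y i)).
apply: le_trans (section_lipschitz hX (@g_partial i) (@g_bound1 i)
  (cw i) (cy i) (cz i)) _.
by rewrite ler_wpM2r// ler_wpM2l// noninc_le.
Qed.

Lemma truncate_lipschitz_first n : lipschitz_first n (fun y => g (truncate n y)).
Proof.
exists (c1 * b 0); first by rewrite mulr_ge0.
exact: truncate_lipschitz.
Qed.

(* The slope of the chord of [g] in the variable y_n between 0 and 1/2, used in
   place of the derivative at 0. *)
Definition slope n y : X :=
  2 *: (g (upd (truncate n y) n 2^-1) - g (truncate n y)).

Lemma unit_interval_half : unit_interval R 2^-1.
Proof. by apply/unit_intervalE; lra. Qed.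

Lemma slope_lipschitz_first n : lipschitz_first n (slope n).
Proof.
have lf : lipschitz_first n (fun y => g (upd (truncate n y) n 2^-1) - g (truncate n y)).
  apply: lipschitz_firstB; last exact: truncate_lipschitz_first.
  exists (c1 * b 0) => [|y z cy cz]; first by rewrite mulr_ge0.
  (* Seen as a truncation at [n.+1], this point falls under [truncate_lipschitz]; the two arguments
     agree in coordinate [n], so the last term vanishes. *)
  have trE u : upd (truncate n u) n 2^-1 = truncate n.+1 (upd u n 2^-1) :> (nat -> R).
    rewrite truncateS; apply/funext => j; rewrite /upd eqxx.
    by case: eqP => // jn; rewrite /truncate; case: ltngtP jn.
  rewrite !trE; have ch := unit_interval_half.
  apply: le_trans (truncate_lipschitz n.+1 (cube_upd n cy ch) (cube_upd n cz ch)) _.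
  rewrite ler_wpM2l ?mulr_ge0// big_ord_recr/= {3 4}/upd eqxx subrr normr0 addr0.
  by apply: ler_sum => j _; rewrite /upd ltn_eqF.
move: lf => [L L0 hL]; exists (2 * L) => [|y z cy cz]; first exact: mulr_ge0.
by rewrite /slope -scalerBr normrZ ger0_norm// -mulrA ler_wpM2l// hL.
Qed.

Lemma slope_le n y : cube R y -> `|slope n y| <= c1 * b n.
Proof.
move=> cy; rewrite /slope normrZ ger0_norm// -{2}(upd_truncate0 n y).
have := section_lipschitz hX (@g_partial n) (@g_bound1 n)
  (cube_truncate n cy) (@unit_interval0 R) unit_interval_half.
rewrite subr0 ger0_norm ?invr_ge0// => h.
by rewrite mulrC -ler_pdivlMr.
Qed.

(** * The martingale part and the remainder *)

Definition martingale s N y : X := \sum_(s <= n < N) y n *: slope n y.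

Lemma martingaleS s N y : (s <= N)%N ->
  martingale s N.+1 y = martingale s N y + y N *: slope N y.
Proof. by move=> sN; rewrite /martingale big_nat_recr. Qed.

Lemma increment_lipschitz_first n N : (n < N)%N ->
  lipschitz_first N (fun y => y n *: slope n y).
Proof.
move=> nN; apply: (@lipschitz_first_bilinear R R X X (fun a x => a *: x)).
- by move=> u u' w; rewrite scalerBl.
- by move=> u w w'; rewrite scalerBr.
- by move=> u w; rewrite normrZ.
- exact: lipschitz_first_coord.
- by apply: lipschitz_firstS (slope_lipschitz_first n); exact: ltnW.
Qed.

Lemma martingale_lipschitz_first s N : (s <= N)%N ->
  lipschitz_first N (martingale s N).
Proof.
move=> /subnKC <-; elim: (N - s)%N => [|d IH].
  rewrite addn0; exists 0 => // y z _ _.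
  by rewrite /martingale !big_geq// subrr normr0 mul0r.
rewrite addnS.
have -> : martingale s (s + d).+1 =
    fun y => martingale s (s + d) y + y (s + d)%N *: slope (s + d) y.
  by apply/funext => y; rewrite martingaleS// leq_addr.
apply: lipschitz_firstD; last exact: increment_lipschitz_first.
exact: lipschitz_firstS IH.
Qed.

Lemma norm_sqr_lipschitz_first n (f : (nat -> R) -> X) :
  lipschitz_first n f -> lipschitz_first n (fun y => `|f y| ^+ 2).
Proof.
move=> lf; under eq_fun do rewrite hX.
apply: (@lipschitz_first_bilinear R X X R ip) => //.
- by move=> u u' w; rewrite ipBl.
- by move=> u w w'; rewrite ipBr.
- exact: cauchy_schwarz hX.
Qed.

Lemma lipschitz_first_integrable n (h : (nat -> R) -> R) :
  lipschitz_first n h -> P.-integrable (cube R) (EFin \o (h : seqspace R -> R)).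
Proof.
move=> lh; have [K _ hK] := lipschitz_first_bounded lh.
apply: (@bounded_integrable R P _ _ (K)) => //; first exact: measurable_cube.
exact: lipschitz_first_measurable lh.
Qed.

(** Induction on [N]: the cross term is [y n] times the inner product of the partial sum and the
    slope, a function of the first [n] variables, so it integrates to 0. The new square is bounded
    using [|y n| <= 1]. *)
Lemma martingale_energy s N : (s <= N)%N ->
  \int[P]_(y in cube R) (`|martingale s N y| ^+ 2) <=
  \sum_(s <= n < N) (c1 * b n) ^+ 2.
Proof.
have mC : measurable (cube R : set (seqspace R)) := @measurable_cube R.
move=> /subnKC <-; elim: (N - s)%N => [|d IH].
  rewrite addn0 big_geq// /martingale.
  under eq_Rintegral do rewrite big_geq// normr0 expr0n/=.
  by rewrite Rintegral_cst// mul0r.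
rewrite addnS; set n := (s + d)%N in IH *.
have sn : (s <= n)%N := leq_addr d s.
have lM := martingale_lipschitz_first sn.
have lF := slope_lipschitz_first n.
have lMF : lipschitz_first n (fun y => ip (martingale s n y) (slope n y)).
  apply: (@lipschitz_first_bilinear R X X R ip) => //.
  - by move=> u u' w; rewrite ipBl.
  - by move=> u w w'; rewrite ipBr.
  - exact: cauchy_schwarz hX.
have i1 := lipschitz_first_integrable (norm_sqr_lipschitz_first lM).
have i2 := lipschitz_first_integrable
  (norm_sqr_lipschitz_first (increment_lipschitz_first (ltnSn n))).
have i3 : P.-integrable (cube R)
    (EFin \o (fun y : seqspace R => y n * ip (martingale s n y) (slope n y))).
  apply: (@lipschitz_first_integrable n.+1).
  apply: (@lipschitz_first_bilinear R R R R (fun u v => u * v)).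
  - by move=> u u' w; rewrite mulrBl.
  - by move=> u w w'; rewrite mulrBr.
  - by move=> u w; rewrite normrM.
  - exact: lipschitz_first_coord.
  - exact: lipschitz_firstS lMF.
rewrite big_nat_recr//=.
under eq_Rintegral do rewrite martingaleS// (norm_sqrD hX) ipZr mulr_natl mulr2n.
rewrite RintegralD//; last 2 first.
- exact: (integrableD mC i1 i2).
- exact: (integrableD mC i3 i3).
rewrite !RintegralD// !(independent_mean_zero hmu hP mu_mean lMF) !addr0.
apply: lerD => //.
apply: (@le_trans _ _ (\int[P]_(y in cube R) ((c1 * b n) ^+ 2))).
  apply: le_Rintegral => //.
    apply: (@bounded_integrable R P _ _ ((c1 * b n) ^+ 2)) => // y _.
    by rewrite ger0_norm// sqr_ge0.
  move=> y cy; rewrite ler_sqr ?nnegrE ?mulr_ge0// normrZ.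
  apply: le_trans (slope_le n cy); rewrite ler_piMl//.
  by have /unit_intervalE := cy n; rewrite ler_norml; lra.
rewrite Rintegral_cst// ler_piMr ?sqr_ge0// -lee_fin fineK ?fin_num_measure//.
exact: probability_le1.
Qed.

(** The one-step errors of [section_interpolation] add up along the telescoping sum. *)
Lemma martingale_remainder s N y : (s <= N)%N -> cube R y ->
  `|g (truncate N y) - g (truncate s y) - martingale s N y| <=
  c2 / 2 * \sum_(s <= n < N) b n ^+ 2.
Proof.
move=> /subnKC <- cy; elim: (N - s)%N => [|d IH].
  by rewrite addn0 /martingale !big_geq// subrr subr0 normr0 mulr0.
rewrite addnS; set n := (s + d)%N in IH *.
have sn : (s <= n)%N := leq_addr d s.
rewrite martingaleS// big_nat_recr//= mulrDr.
have -> : g (truncate n.+1 y) - g (truncate s y) - (martingale s n y + y n *: slope n y) =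
    (g (truncate n y) - g (truncate s y) - martingale s n y) +
    (g (truncate n.+1 y) - g (truncate n y) - y n *: slope n y).
  by rewrite opprD [RHS]addrACA; congr (_ + _); rewrite [RHS]addrC addrA subrK.
rewrite (le_trans (ler_normD _ _))// lerD//.
have := section_interpolation hX (@g_partial n) (@g_partial2 n)
  (@g_bound2 n) (cube_truncate n cy) (cy n).
by rewrite -truncateS upd_truncate0 mulrAC.
Qed.

(** A cruder bound by the l^1 tail of [b], uniform in [y]; it serves to make the convergence in (1)
    uniform. *)
Lemma truncate_increment s N y : (s <= N)%N -> cube R y ->
  `|g (truncate N y) - g (truncate s y)| <= c1 * \sum_(s <= n < N) b n.
Proof.
move=> sN cy; have -> : g (truncate N y) - g (truncate s y) =
    \sum_(s <= n < N) (g (truncate n.+1 y) - g (truncate n y)).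
  by rewrite (telescope_sumr (fun n => g (truncate n y))).
rewrite mulr_sumr.
apply: (le_trans (ler_norm_sum _ _ _)); apply: ler_sum => n _.
rewrite truncateS -{2}(upd_truncate0 n y).
apply: le_trans (section_lipschitz hX (@g_partial n) (@g_bound1 n)
  (cube_truncate n cy) (@unit_interval0 R) (cy n)) _.
rewrite subr0 ler_piMr ?mulr_ge0//.
by have /unit_intervalE := cy n; rewrite ler_norml; lra.
Qed.

(** The error splits into martingale, remainder and the part beyond [N]; then
    [(m + r)^2 <= 2 m^2 + 2 r^2]. *)
Lemma truncation_error_le s N (e : R) y : (s <= N)%N -> cube R y ->
  `|g y - g (truncate N y)| <= e ->
  `|g y - g (truncate s y)| ^+ 2 <=
    2 * `|martingale s N y| ^+ 2 +
    2 * (c2 / 2 * \sum_(s <= n < N) b n ^+ 2 + e) ^+ 2.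
Proof.
move=> sN cy he; have hr := martingale_remainder sN cy.
set r := c2 / 2 * _ in hr *; set M := martingale s N y in hr *.
have h : `|g y - g (truncate s y)| <= `|M| + (r + e).
  have -> : g y - g (truncate s y) = M +
      (g (truncate N y) - g (truncate s y) - M + (g y - g (truncate N y))).
    by rewrite addrA subrKC addrC addrA subrK.
  rewrite (le_trans (ler_normD _ _))// lerD2l (le_trans (ler_normD _ _))// lerD//.
have := normr_ge0 (g y - g (truncate s y)).
move: (`|_|) h => a h a0; have := normr_ge0 M; move: (`|M|) h => m h m0.
have : a ^+ 2 <= (m + (r + e)) ^+ 2 by rewrite ler_sqr ?nnegrE ?(le_trans a0).
have := sqr_ge0 (m - (r + e)); nra.
Qed.

(** * Strong measurability and the convergence rate *)

Variable p : R.
Hypotheses (p_gt0 : 0 < p) (p_lt1 : p < 1).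
Hypothesis b_lp : cvgn (series (fun j => b j `^ p)).
Hypothesis g_cvg : {ae P, forall y : nat -> R, cube R y ->
  `|g y - g (truncate s y)| @[s --> \oo] --> 0}.

Lemma strongly_measurable_error s :
  strongly_measurable P (cube R) (fun y => g y - g (truncate s y)).
Proof.
pose F n m (q : {ffun 'I_n -> 'I_m.+2}) : X :=
  g (truncate n (grid_decode R q)) - g (truncate s (grid_decode R q)).
(* The mesh is about [1 / n^2] while at most [n] coordinates are rounded, so the total rounding
   error is at most [1 / n] up to the Lipschitz constant. *)
exists (fun n y => F n (n * n)%N (grid_code n (n * n) y)).
  by move=> n; exact: simple_grid_code.
apply: (@filterS _ _ (ae_filter_ringOfSetsType P) _ _ _ g_cvg) => y gy cy; have {}gy := gy cy.
pose L := c1 * b 0.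
have L0 : 0 <= L by rewrite mulr_ge0.
have round_le n i : (i <= n)%N -> (0 < n)%N ->
    `|g (truncate i y) - g (truncate i (grid_round n (n * n) y))| <= L / n%:R.
  move=> in_ n0.
  apply: le_trans (truncate_lipschitz i cy (cube_grid_round n (n * n) y)) _.
  rewrite -/L ler_wpM2l//.
  apply: (@le_trans _ _ (\sum_(j < i) (n * n).+1%:R^-1)).
    apply: ler_sum => j _; apply: grid_round_close => //.
    exact: leq_trans (ltn_ord j) in_.
  have n0' : 0 < n%:R :> R by rewrite ltr0n.
  rewrite sumr_const card_ord -[leLHS]mulr_natr ler_pdivrMl//.
  rewrite ler_pdivlMr// -natrM ler_nat (leq_trans (leq_mul in_ (leqnn n)))//.
apply/cvgrPdist_le => e e0.
have e3 : 0 < e / 3 by rewrite divr_gt0.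
move: gy => /cvgrPdist_le /(_ _ e3) gy.
near=> n.
have n0 : (0 < n)%N by near: n; exact: nbhs_infty_ge.
have sn : (s <= n)%N by near: n; exact: nbhs_infty_ge.
have Ln : L / n%:R <= e / 3.
  rewrite ler_pdivrMr ?ltr0n// mulrC -ler_pdivrMr//.
  by near: n; exact: nbhs_infty_ger.
have gn : `|0 - `|g y - g (truncate n y)| | <= e / 3 by near: n; exact: gy.
rewrite sub0r normrN normr_id in gn.
rewrite /F -/(grid_round n (n * n) y).
set r := grid_round _ _ _.
have -> : g y - g (truncate s y) - (g (truncate n r) - g (truncate s r)) =
  (g y - g (truncate n y)) + (g (truncate n y) - g (truncate n r)) -
  (g (truncate s y) - g (truncate s r)).
  by rewrite addrA subrK [in LHS]opprD [in LHS]addrACA -opprD.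
apply: le_trans (ler_normB _ _) _.
have -> : e = e / 3 + e / 3 + e / 3 by field.
apply: lerD; last exact: le_trans (round_le n s sn n0) Ln.
apply: le_trans (ler_normD _ _) _; apply: lerD => //.
exact: le_trans (round_le n n (leqnn n) n0) Ln.
Unshelve. all: by end_near. Qed.

Let B := limn (series (fun j => b j `^ p)).
Let T := B `^ ((2 - p) / p) * B.

(** The increments from [n] to a later [m] are small uniformly in [m] and [y]; letting [m] grow at a
    point of convergence passes the bound to [g]. *)
Lemma tail_uniform (e : R) : 0 < e -> exists N, forall n, (N <= n)%N ->
  {ae P, forall y : nat -> R, cube R y -> `|g y - g (truncate n y)| <= e}.
Proof.
move=> e0; have c10 : 0 < c1 + 1 by rewrite ltr_wpDl.
have [N hN] := lp_tail_small b_ge0 b_lp b_noninc (ltW p_lt1) (divr_gt0 e0 c10).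
exists N => n Nn; apply: (@filterS _ _ (ae_filter_ringOfSetsType P) _ _ _ g_cvg) => y gy cy.
have {gy} /cvgrPdist_le gy := gy cy.
apply/ler_addgt0Pr => d d0; have {gy} := gy _ d0 => -[M _ hM].
pose m := maxn n M.
have := hM m (leq_maxr _ _); rewrite /= sub0r normrN normr_id => h.
have -> : g y - g (truncate n y) =
    (g (truncate m y) - g (truncate n y)) + (g y - g (truncate m y)).
  by rewrite [RHS]addrC addrA subrK.
apply: le_trans (ler_normD _ _) _; apply: lerD => //.
apply: le_trans (truncate_increment (leq_maxl n M) cy) _.
apply: (@le_trans _ _ ((c1 + 1) * (e / (c1 + 1)))); last by rewrite mulrCA divff ?mulr1// gt_eqF.
by apply: ler_pM; rewrite ?sumr_ge0 ?hN// lerDl.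
Qed.

Lemma truncation_error_L2 s : (1 <= s)%N ->
  (\int[P]_(y in cube R) (`|g y - g (truncate s y)| ^+ 2)%:E <=
   ((2 * c1 ^+ 2 * T + c2 ^+ 2 * T ^+ 2 + 4) * s%:R `^ (1 - 2 / p))%:E)%E.
Proof.
move=> s1; have mC : measurable (cube R : set (seqspace R)) := @measurable_cube R.
have s0 : 0 < s%:R :> R by rewrite ltr0n.
pose q := s%:R `^ (1 - 2 / p).
(* The part beyond [N] is allowed to be as large as the target rate; its square is exactly [q]. *)
pose e := s%:R `^ (- (1 / p) + 1 / 2).
have p2 : 1 < 1 / p by rewrite ltr_pdivlMr// mul1r.
have q_gt0 : 0 < q by rewrite powR_gt0.
(* This lets the squared remainder, of order [q^2], be absorbed into order [q]. *)
have q_le1 : q <= 1.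
  rewrite -(powRr0 s%:R); apply: ler_powR; first by rewrite ler1n.
  by rewrite subr_le0 ler_pdivlMr // mul1r (le_trans (ltW p_lt1))// ler1n.
have e_gt0 : 0 < e by rewrite powR_gt0.
have eq2 : e ^+ 2 = q.
  rewrite -powR_mulrn ?powR_ge0// -powRrM; congr (_ `^ _).
  by field; rewrite gt_eqF.
have T0 : 0 <= T by rewrite mulr_ge0 ?powR_ge0// (lp_norm_ge0 b_lp).
have [N0 hN0] := tail_uniform e_gt0.
pose N := maxn s N0; have sN : (s <= N)%N := leq_maxl _ _.
pose tau := \sum_(s <= n < N) b n ^+ 2.
have tau0 : 0 <= tau by apply: sumr_ge0 => j _; exact: sqr_ge0.
have tauq : tau <= T * q.
  by apply: lp_tail_sqr => //; rewrite (lt_trans p_lt1)// ltr1n.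
pose M := martingale s N.
pose c := c2 / 2 * tau + e.
have iM : P.-integrable (cube R) (EFin \o (fun y : seqspace R => `|M y| ^+ 2)).
  apply: lipschitz_first_integrable; apply: norm_sqr_lipschitz_first.
  exact: martingale_lipschitz_first.
have iM2 : P.-integrable (cube R) (EFin \o (fun y : seqspace R => 2 * `|M y| ^+ 2)).
  exact: (integrableZl mC 2 iM).
have ic : P.-integrable (cube R) (EFin \o (fun y : seqspace R => 2 * c ^+ 2)).
  apply: (@bounded_integrable R P _ _ (2 * c ^+ 2)) => // y _.
  by rewrite ger0_norm// mulr_ge0// sqr_ge0.
have iw := integrableD mC iM2 ic.
have key : (\int[P]_(y in cube R) (`|g y - g (truncate s y)| ^+ 2)%:E <=
    \int[P]_(y in cube R) ((2 * `|M y| ^+ 2 + 2 * c ^+ 2)%R)%:E)%E.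
  apply: ae_ge0_le_integral_dominated.
  - exact: mC.
  - by move=> y _; rewrite lee_fin sqr_ge0.
  - by move=> y _; rewrite lee_fin addr_ge0// mulr_ge0// sqr_ge0.
  - exact: measurable_int iw.
  - apply: (@filterS _ _ (ae_filter_ringOfSetsType P) _ _ _
      (hN0 N (leq_maxr _ _))) => y hy cy; rewrite lee_fin.
    exact: (truncation_error_le sN cy (hy cy)).
apply: (le_trans key); rewrite -[leLHS]fineK; last exact: integrable_fin_num iw.
rewrite lee_fin -/(Rintegral P (cube R) (fun y => 2 * `|M y| ^+ 2 + 2 * c ^+ 2)).
rewrite RintegralD// Rintegral_cst// RintegralZl//.
have EM : \int[P]_(y in cube R) (`|M y| ^+ 2) <= c1 ^+ 2 * tau.
  apply: le_trans (martingale_energy sN) _.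
  by rewrite mulr_sumr; apply: ler_sum => j _; rewrite exprMn.
have Pc : 2 * c ^+ 2 * fine (P (cube R)) <= 2 * c ^+ 2.
  apply: ler_piMr; first by rewrite mulr_ge0 ?sqr_ge0.
  rewrite -lee_fin fineK ?fin_num_measure//.
  exact: probability_le1.
(* From [2 (a + e)^2 <= 4 a^2 + 4 e^2] with [a = c2 tau / 2]; this is the source of the 4 in the
   constant. *)
have cE : 2 * c ^+ 2 <= c2 ^+ 2 * tau ^+ 2 + 4 * q.
  by rewrite /c -eq2; have := sqr_ge0 (c2 / 2 * tau - e); nra.
have h1 : c1 ^+ 2 * tau <= c1 ^+ 2 * (T * q) by rewrite ler_wpM2l// sqr_ge0.
have h2 : tau ^+ 2 <= T ^+ 2 * q.
  apply: (@le_trans _ _ ((T * q) ^+ 2)).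
    by rewrite ler_sqr ?nnegrE// mulr_ge0// ltW.
  by rewrite exprMn ler_wpM2l ?sqr_ge0// expr2 ler_piMr// ltW.
have h3 : c2 ^+ 2 * tau ^+ 2 <= c2 ^+ 2 * (T ^+ 2 * q) by rewrite ler_wpM2l// sqr_ge0.
rewrite -/q; lra.
Qed.

Lemma truncation_error_rate : exists2 C : R, 0 < C & forall s : nat, (1 <= s)%N ->
    in_L2 P (cube R) (fun y => g y - g (truncate s y)) /\
    (L2norm P (cube R) (fun y => (g y - g (truncate s y))%R) <=
       (C * (s%:R `^ (- (1 / p) + 1 / 2)))%:E)%E.
Proof.
pose K := 2 * c1 ^+ 2 * T + c2 ^+ 2 * T ^+ 2 + 4.
have T0 : 0 <= T by rewrite mulr_ge0 ?powR_ge0// (lp_norm_ge0 b_lp).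
have K0 : 0 < K.
  have h1 : 0 <= 2 * c1 ^+ 2 * T by rewrite mulr_ge0// mulr_ge0// sqr_ge0.
  have h2 : 0 <= c2 ^+ 2 * T ^+ 2 by rewrite mulr_ge0// sqr_ge0.
  exact: ltr_wpDl (addr_ge0 h1 h2) _.
exists (K `^ 2^-1) => [|s s1]; first exact: powR_gt0.
have H : (L2norm P (cube R) (fun y => (g y - g (truncate s y))%R) <=
       (K `^ 2^-1 * (s%:R `^ (- (1 / p) + 1 / 2)))%:E)%E.
  have -> : - (1 / p) + 1 / 2 = (1 - 2 / p) * 2^-1.
    by field; rewrite gt_eqF.
  rewrite powRrM -powRM ?powR_ge0 ?(ltW K0)// -poweR_EFin /L2norm.
  apply: gt0_ler_poweR => //; rewrite ?in_itv/= ?leey ?andbT.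
  - by apply: integral_ge0 => y _; rewrite lee_fin sqr_ge0.
  - by rewrite lee_fin mulr_ge0 ?powR_ge0// ltW.
  - exact: truncation_error_L2.
split=> //; split; first exact: strongly_measurable_error.
exact: le_lt_trans H (ltry _).
Qed.

End TruncationError.

(** * Conclusion *)

Theorem theorem1 (R : realType) (X : completeNormedModType R)
    (ip : {dot X for idfun}) (hX : norm_from_inner ip) (sepX : separable X)
    (mu : probability (measurableTypeR R) R)
    (hmu : mu (unit_interval R) = 1%E)
    (P : probability (seqspace R) R) (hP : is_countable_power mu P)
    (p : R) (p_gt0 : 0 < p) (p_lt1 : p < 1)
    (k : nat) (hk : k%:Z = Num.ceil (1 / (1 - p)))
    (g : (nat -> R) -> X)
    (h1 : {ae P, forall y : nat -> R, cube R y ->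
             `|g y - g (truncate s y)| @[s --> \oo] --> 0})
    (Theta : nat -> R) (Theta_ge0 : forall l, 0 <= Theta l)
    (b : nat -> R) (b_ge0 : forall j, 0 <= b j)
    (b_lp : cvgn (series (fun j => b j `^ p)))
    (b_noninc : forall j, b j.+1 <= b j)
    (g_diff : cont_diff k.+1 g)
    (g_bound : forall y : nat -> R, cube R y ->
       forall nu : multiindex, (mabs nu <= k.+1)%N ->
         `|mpartial nu g y| <= Theta (mabs nu) * mpow b nu)
    (mu_mean : (\int[mu]_(x in unit_interval R) x%:E = 0)%E)
    (Cmu : R) (Cmu_ge0 : 0 <= Cmu)
    (mu_moments : forall m : nat, (2 <= m)%N ->
       (\int[mu]_(x in unit_interval R) (`|x| ^+ m)%:E <= Cmu%:E)%E) :
  exists2 C : R, 0 < C & forall s : nat, (1 <= s)%N ->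
    in_L2 P (cube R) (fun y => g y - g (truncate s y)) /\
    (L2norm P (cube R) (fun y => (g y - g (truncate s y))%R) <=
       (C * (s%:R `^ (- (1 / p) + 1 / 2)))%:E)%E.
Proof.
(* Since [1 / (1 - p)] is positive its ceiling is at least 1, so derivatives up to order 2 are
   available. *)
have k1 : (1 <= k)%N.
  have : 0 < k%:Z by rewrite hk ceil_gt0 divr_gt0// subr_gt0.
  by rewrite ltz_nat.
have g_partial j z : cube R z -> has_partial j g z.
  by have [_ /(_ isT)] := g_diff [::] isT; apply.
have g_partial2 j z : cube R z -> has_partial j (partial j g) z.
  by have [_ /(_ k1)] := g_diff [:: j] isT; apply.
(* Pure derivatives in one variable; orders 1 and 2 give the constants [Theta 1] and [Theta 2]. *)
have bound j z m : (m.+1 <= k.+1)%N -> cube R z ->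
    `|iter_partial (nseq m.+1 j) g z| <= Theta m.+1 * b j ^+ m.+1.
  move=> mk cz; have := g_bound z cz (single_multiindex j m.+1).
  by rewrite mabs_single mpow_single mpartial_single; apply.
apply: (truncation_error_rate hX hmu hP mu_mean (Theta_ge0 1%N) b_ge0 b_noninc
  g_partial g_partial2 _ _ p_gt0 p_lt1 b_lp h1).
- by move=> j z cz; exact: (bound j z 0%N isT cz).
- by move=> j z cz; exact: (bound j z 1%N k1 cz).
Qed.
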